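(* Let $k$ be a positive integer and let $G$ be a finite, simple, undirected, connected graph with degeneracy $k$. Then $\zeta(G) \ge \log_3(k+1)$, where $\zeta(G)$ is the localization number of $G$.
   Context: Degeneracy: the degeneracy of a graph $G$ is the maximum, over all (nonempty) subgraphs $H$ of $G$, of the minimum degree $\delta(H)$. Localization game: let $G$ be a finite, simple, undirected, connected graph and $m$ a positive integer. One player controls $m$ cops, the other controls an invisible robber. The robber first chooses a starting vertex $r_1$. In round $t=1,2,\dots$, the cops choose vertices $u_1,\dots,u_m$ of $G$ (arbitrarily; they are not restricted to moving to neighboring vertices, and the choice may depend on all earlier probes and their results) and learn the distance vector $(d_G(u_1,r_t),\dots,d_G(u_m,r_t))$; then the robber either stays or moves to a neighbor, so $r_{t+1}=r_t$ or $r_{t+1}$ is adjacent to $r_t$. The cops capture the robber in round $t$ if, after the probe of round $t$, the robber's current vertex $r_t$ is uniquely determined by the information the cops have received, i.e. all robber trajectories $r'_1,\dots,r'_t$ (consecutive vertices equal or adjacent) consistent with all the distance vectors received so far satisfy $r'_t=r_t$. The cops have a winning strategy if they have a strategy that captures the robber after finitely many rounds against every possible robber trajectory (equivalently, even a robber who knows the cops' entire strategy in advance). The robber wins if he is never captured. The localization number $\zeta(G)$ is the least positive integer $m$ for which $m$ cops have a winning strategy on $G$. *)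

(* Defs.v *)
(* A finite simple graph on a finType T is given by its
   adjacency relation e : rel T, assumed symmetric and irreflexive. *)
From mathcomp Require Import all_boot all_order all_algebra.
From mathcomp Require Import boolp classical_sets reals exp.

Set Implicit Arguments.
Unset Strict Implicit.
Unset Printing Implicit Defensive.

Import Order.TTheory GRing.Theory Num.Theory.

Definition connected_graph (T : finType) (e : rel T) : Prop :=
  forall x y : T, connect e x y.

Definition log (R : realType) (b x : R) : R := (ln x / ln b)%R.

Section Degeneracy.

Variables (T : finType) (e : rel T).

(* A subgraph, not necessarily induced, is a pair H of a vertex set H.1 and a
   symmetric set H.2 of ordered pairs, its adjacency relation. *)
Definition is_subgraph (H : {set T} * {set T * T}) : bool :=
  [forall x, forall y, ((x, y) \in H.2) ==>
     [&& e x y, x \in H.1, y \in H.1 & (y, x) \in H.2]].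

Definition degree (H : {set T} * {set T * T}) (x : T) : nat :=
  #|[set y | (x, y) \in H.2]|.

(* All degrees are at most #|T|, so the default value #|T| is harmless as soon
   as H.1 is nonempty. *)
Definition min_degree (H : {set T} * {set T * T}) : nat :=
  \big[minn/#|T|]_(x in H.1) degree H x.

Definition degeneracy : nat :=
  \max_(H : {set T} * {set T * T} | is_subgraph H && (H.1 != finset.set0))
     min_degree H.

End Degeneracy.

Section Localization.

Variables (T : finType) (e : rel T).

(* The least n < #|T| such that there is a walk of length n from u to v, and
   #|T| if there is none; in a connected graph distances are below #|T|. *)
Definition dist (u v : T) : nat :=
  find (fun n => [exists p : n.-tuple T, path e u p && (last u p == v)])
       (iota 0 #|T|).

Definition dist_vector (m : nat) (u : m.-tuple T) (v : T) : m.-tuple nat :=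
  [tuple dist (tnth u i) v | i < m].

(* The next probe as a function of the earlier probes and their results, listed
   in chronological order. *)
Definition strategy (m : nat) : Type :=
  seq (m.-tuple T * m.-tuple nat) -> m.-tuple T.

(* Rounds are numbered from 0: the robber is at r t when probe number t is made. *)
Definition move (x y : T) : bool := (y == x) || e x y.

Definition trajectory (r : nat -> T) : Prop := forall t, move (r t) (r t.+1).

(* What the cops know before probe number t. *)
Fixpoint history (m : nat) (S : strategy m) (r : nat -> T) (t : nat) :
    seq (m.-tuple T * m.-tuple nat) :=
  if t is t'.+1 then
    let h := history S r t' in rcons h (S h, dist_vector (S h) (r t'))
  else [::].

Definition probe (m : nat) (S : strategy m) (r : nat -> T) (t : nat) :
    m.-tuple T := S (history S r t).

Definition captured (m : nat) (S : strategy m) (r : nat -> T) (t : nat) : Prop :=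
  forall r' : nat -> T,
    (forall i, i < t -> move (r' i) (r' i.+1)) ->
    (forall i, i <= t ->
       dist_vector (probe S r i) (r' i) = dist_vector (probe S r i) (r i)) ->
    r' t = r t.

Definition cops_win (m : nat) : Prop :=
  exists S : strategy m,
    forall r : nat -> T, trajectory r -> exists t, captured S r t.

Definition is_localization_number (m : nat) : Prop :=
  [/\ 0 < m, cops_win m & forall m', 0 < m' -> cops_win m' -> m <= m'].

(* The default value 0 is not reached when T is nonempty: #|T| cops win at once
   by probing every vertex. *)
Definition localization_number : nat := xget 0 is_localization_number.

End Localization.

(* Main.v *)
Require Import Defs.
From mathcomp Require Import all_boot all_order all_algebra.
From mathcomp Require Import boolp classical_sets reals exp.
From mathcomp Require Import zify.

(** Adjacent vertices have almost the same distance to any probe: along an edge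
    a distance changes by -1, 0 or 1. Hence, once a vertex [v] and a probe of [m]
    vertices are fixed, the vertices of the closed neighbourhood of [v] realise
    at most [3 ^ m] distance vectors ([closed_nbh_twins]).

    Take a subgraph [H] whose minimum degree is the degeneracy [k], and suppose
    [3 ^ m <= k]. A robber standing in [H] knows the next probe, since it is a
    function of the history, and has at least [k + 1 > 3 ^ m] vertices of [H] to
    choose from, so two of them answer the probe identically. Moving to one of
    these twins leaves the other one consistent with everything the cops know, and
    the robber is still in [H] and can repeat this forever
    ([robber_evades]). So [m] winning cops satisfy [k + 1 <= 3 ^ m]. It remains to
    apply this to the localization number itself, which is a winning number of
    cops because probing all vertices wins at once. *)

(** * Distances along an edge *)

Section Distance.

Set Implicit Arguments.
Unset Strict Implicit.

Variables (T : finType) (e : rel T).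

Lemma dist_walk_le (u : T) (p : seq T) :
  path e u p -> dist e u (last u p) <= size p.
Proof.
move=> ep; rewrite /dist; set a := (a in find a).
have le_find : find a (iota 0 #|T|) <= #|T|.
  by rewrite -[leqRHS](size_iota 0) find_size.
have [ltpT|] := ltnP (size p) #|T|; last exact: leq_trans.
rewrite leqNgt; apply/negP => /(before_find 0).
rewrite nth_iota // add0n /a => /negbT/negP; apply.
by apply/existsP; exists (in_tuple p); rewrite ep /=.
Qed.

Lemma dist_lt_walk (u v : T) : dist e u v < #|T| ->
  exists p : seq T, [/\ path e u p, last u p = v & size p = dist e u v].
Proof.
rewrite /dist; set a := (a in find a) => lt_dT.
have : has a (iota 0 #|T|) by rewrite has_find size_iota.
move=> /(nth_find 0); rewrite nth_iota // add0n.
by case/existsP=> p /andP[ep /eqP lp]; exists p; rewrite size_tuple.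
Qed.

Lemma dist_refl (u : T) : dist e u u = 0.
Proof. by apply/eqP; rewrite -leqn0 (@dist_walk_le u [::]). Qed.

Lemma dist_eq0 (u v : T) : dist e u v = 0 -> v = u.
Proof.
move=> duv0; have [|p [_ lp]] := @dist_lt_walk u v.
  by rewrite duv0; apply/card_gt0P; exists u.
by rewrite duv0 -lp => /size0nil ->.
Qed.

(** A shortest walk to [x] extends to [y]; when no walk from [u] reaches [x],
    the default value [#|T|] of the distance bounds every distance. *)
Lemma dist_edge_le (u x y : T) : e x y -> dist e u y <= (dist e u x).+1.
Proof.
move=> exy; have [lt_dT|le_Td] := ltnP (dist e u x) #|T|.
  have [p [ep lp <-]] := dist_lt_walk lt_dT.
  have := @dist_walk_le u (rcons p y).
  by rewrite rcons_path ep lp exy last_rcons size_rcons; apply.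
apply: (leq_trans _ (leqW le_Td)).
by rewrite -[leqRHS](size_iota 0) find_size.
Qed.

Lemma dist_move_le (e_sym : symmetric e) (u x y : T) : move e x y ->
  dist e u y <= (dist e u x).+1 /\ dist e u x <= (dist e u y).+1.
Proof.
case/orP=> [/eqP ->//|exy].
by split; apply: dist_edge_le; rewrite // e_sym.
Qed.

(** The probe answers on the closed neighbourhood of [v] are encoded by the
    offsets of the distances from those of [v], shifted by one to lie in
    [0, 1, 2]; there are [3 ^ m] codes. *)
Lemma closed_nbh_twins (e_sym : symmetric e) (m : nat) (u : m.-tuple T)
    (v : T) (A : {set T}) :
  {in A, forall x, move e v x} -> 3 ^ m < #|A| ->
  exists x y, [/\ x \in A, y \in A, x != y
                & dist_vector e u x = dist_vector e u y].
Proof.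
move=> mvA ltA.
pose code (x : T) : {ffun 'I_m -> 'I_3} :=
  [ffun i => inord ((dist e (tnth u i) x).+1 - dist e (tnth u i) v)].
have : ~~ [forall x in A, forall y in A, (code x == code y) ==> (x == y)].
  apply/negP => /forall_inP inj.
  have inj_code : {in A &, injective code}.
    by move=> x y xA yA cxy; apply/eqP; move/forall_inP: (inj x xA) => /(_ y yA);
       rewrite cxy eqxx.
  have := max_card (mem [set code x | x in A]).
  by rewrite (card_in_imset inj_code) card_ffun !card_ord leqNgt ltA.
case/forall_inPn=> x xA /forall_inPn[y yA]; rewrite negb_imply => /andP[/eqP cxy nxy].
exists x, y; split=> //; apply: eq_from_tnth => i; rewrite !tnth_mktuple.
have [dx1 dx2] := @dist_move_le e_sym (tnth u i) v x (mvA x xA).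
have [dy1 dy2] := @dist_move_le e_sym (tnth u i) v y (mvA y yA).
have /(congr1 val) : code x i = code y i by rewrite cxy.
by rewrite !ffunE /= !inordK; lia.
Qed.

(** * Subgraphs of large minimum degree *)

Lemma min_degree_le (H : {set T} * {set T * T}) (x : T) :
  x \in H.1 -> min_degree H <= degree H x.
Proof.
move=> xH; rewrite /min_degree; move: (mem_index_enum x).
elim: (index_enum T) => // z s IHs; rewrite inE big_cons => /orP[/eqP <-|/IHs le_s].
  by rewrite xH geq_minl.
by case: ifP => // _; apply: leq_trans (geq_minr _ _) le_s.
Qed.

Lemma degeneracy_subgraph : 0 < degeneracy e ->
  exists H, [/\ is_subgraph e H, H.1 != finset.set0
              & {in H.1, forall x, degeneracy e <= degree H x}].
Proof.
move=> deg_gt0.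
have [H H_sub degE] : exists2 H : {set T} * {set T * T},
    is_subgraph e H && (H.1 != finset.set0) & degeneracy e = min_degree H.
  (* A positive maximum is not the default value of an empty range. *)
  have [H0 H0P|none] := pickP
      (fun H : {set T} * {set T * T} => is_subgraph e H && (H.1 != finset.set0)).
    by exists [arg max_(H > H0 | is_subgraph e H && (H.1 != finset.set0))
                 min_degree H];
      [case: arg_maxnP | exact: bigmax_eq_arg].
  by move: deg_gt0; rewrite /degeneracy big_pred0.
case/andP: H_sub => H_sub H_n0; exists H; split=> // x xH.
by rewrite degE min_degree_le.
Qed.

(** Staying put is a move, so the vertex itself brings the degree [d] up to
    [d + 1] options. *)
Lemma subgraph_closed_nbh (e_irr : irreflexive e)
    (H : {set T} * {set T * T}) (v : T) :
  is_subgraph e H -> v \in H.1 ->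
  exists A : {set T}, [/\ {in A, forall x, move e v x},
    {subset A <= H.1} & #|A| = (degree H v).+1].
Proof.
move=> /forallP H_sub vH.
have edgeP x : (v, x) \in H.2 -> e v x && (x \in H.1).
  by move=> vx; have /forallP/(_ x) := H_sub v; rewrite vx => /and4P[-> _ ->].
exists (v |: [set x | (v, x) \in H.2]); split=> [x|x|].
- rewrite !inE /move => /orP[->//|/edgeP/andP[->]].
  by rewrite orbT.
- by rewrite !inE => /orP[/eqP ->//|/edgeP/andP[]].
- rewrite cardsU1 inE; suff -> : (v, v) \notin H.2 by [].
  by apply/negP => /edgeP; rewrite e_irr.
Qed.

(** * The evading robber *)

(** The trajectory is built together with the history that it produces: in
    state [(h, v)] the robber, coming from [v], answers the probe [S h] from the
    vertex [choice (S h) v]. *)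
Fixpoint robber_state (m : nat) (S : strategy T m) (choice : m.-tuple T -> T -> T)
    (v0 : T) (t : nat) : seq (m.-tuple T * m.-tuple nat) * T :=
  if t is t'.+1 then
    let: (h, v) := robber_state S choice v0 t' in
    let x := choice (S h) v in (rcons h (S h, dist_vector e (S h) x), x)
  else ([::], v0).

Lemma history_robber_state (m : nat) (S : strategy T m)
    (choice : m.-tuple T -> T -> T) (v0 : T) (t : nat) :
  history e S (fun i => (robber_state S choice v0 i.+1).2) t
    = (robber_state S choice v0 t).1.
Proof.
elim: t => [//|t IHt] /=; rewrite IHt.
by case: (robber_state S choice v0 t).
Qed.

(** The state [v0] precedes the first probe, so that the robber picks a twin in
    round 0 as well. *)
Lemma robber_evades (m : nat) (B : {set T}) :
  B != finset.set0 ->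
  (forall u : m.-tuple T, {in B, forall v, exists x y,
     [/\ x \in B, move e v x /\ move e v y, x != y
       & dist_vector e u x = dist_vector e u y]}) ->
  ~ cops_win e m.
Proof.
case/set0Pn=> v0 v0B twins [S Swin].
have twins_ex (u : m.-tuple T) v : exists xy : T * T, v \in B ->
    [/\ xy.1 \in B, move e v xy.1 /\ move e v xy.2, xy.1 != xy.2
      & dist_vector e u xy.1 = dist_vector e u xy.2].
  have [vB|_] := boolP (v \in B); last by exists (v, v).
  by have [x [y Pxy]] := twins u v vB; exists (x, y).
pose twin (u : m.-tuple T) v := sval (cid (twins_ex u v)).
have twinP (u : m.-tuple T) v (vB : v \in B) := svalP (cid (twins_ex u v)) vB.
pose st := robber_state S (fun u v => (twin u v).1) v0.
pose r i := (st i.+1).2.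
have stS t : r t = (twin (S (st t).1) (st t).2).1.
  by rewrite /r /st /=; case: (robber_state _ _ _ t).
have stB t : (st t).2 \in B.
  by elim: t => [//|t IHt]; rewrite -/(r t) stS; case: (twinP (S (st t).1) _ IHt).
have r_move t : move e (st t).2 (r t).
  by rewrite stS; case: (twinP (S (st t).1) _ (stB t)) => _ [].
have [t capt] : exists t, captured e S r t by apply: Swin => t; apply: r_move.
have [_ [_ mvy] neq_xy eq_xy] := twinP (S (st t).1) _ (stB t).
(* The decoy follows the robber and sits on the other twin in round [t]. *)
pose y := (twin (S (st t).1) (st t).2).2.
pose r' i := if i == t then y else r i.
have : r' t = r t.
  apply: capt => i.
    move=> lt_it; rewrite /r' (ltn_eqF lt_it).
    by case: eqP => [it|_]; [move: mvy; rewrite /y -it | apply: r_move].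
  rewrite /r' => _; case: eqP => // ->.
  by rewrite /probe history_robber_state stS -eq_xy.
by rewrite /r' eqxx stS => yx; rewrite /y in yx; rewrite yx eqxx in neq_xy.
Qed.

Lemma cops_win_degeneracy (e_sym : symmetric e) (e_irr : irreflexive e)
    (m : nat) :
  0 < degeneracy e -> cops_win e m -> degeneracy e < 3 ^ m.
Proof.
move=> deg_gt0 win; rewrite ltnNge; apply/negP => le_deg.
have [H [H_sub H_n0 H_deg]] := degeneracy_subgraph deg_gt0.
apply: robber_evades H_n0 _ win => u v vH.
have [A [mvA subA cardA]] := subgraph_closed_nbh e_irr H_sub vH.
have [|x [y [xA yA nxy eq_xy]]] := closed_nbh_twins e_sym u mvA.
  by rewrite cardA ltnS (leq_trans le_deg) // H_deg.
by exists x, y; split=> //; [apply: subA | split; apply: mvA].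
Qed.

(** * The localization number wins *)

(** Probing all vertices locates the robber, as the vertex at distance 0 from
    its own position. *)
Lemma cops_win_card : cops_win e #|T|.
Proof.
exists (fun=> enum_tuple T) => r _; exists 0 => r' _ /(_ 0 (leqnn _)).
rewrite /probe => /(congr1 (fun w => tnth w (enum_rank (r 0)))).
rewrite !tnth_mktuple.
have -> : tnth (enum_tuple T) (enum_rank (r 0)) = r 0.
  by rewrite (tnth_nth (r 0)) -[RHS]enum_rankK (enum_val_nth (r 0)).
by rewrite dist_refl => /dist_eq0.
Qed.

Lemma localization_numberP :
  0 < #|T| -> is_localization_number e (localization_number e).
Proof.
move=> T_gt0; apply: xgetPex.
have ex_win : exists m, (0 < m) && `[< cops_win e m >].
  by exists #|T|; rewrite T_gt0; apply/asboolP/cops_win_card.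
case: (ex_minnP ex_win) => m /andP[m_gt0 /asboolP m_win] m_min.
exists m; split=> // m' m'_gt0 m'_win.
by apply: m_min; rewrite m'_gt0; apply/asboolP.
Qed.

End Distance.

Import Order.TTheory GRing.Theory Num.Theory.

Theorem theorem2p1 (R : realType) (T : finType) (e : rel T) (k : nat)
    (e_sym : symmetric e) (e_irr : irreflexive e) (e_conn : connected_graph e)
    (k_gt0 : (0 < k)%N) (e_deg : degeneracy e = k) :
  (log 3%:R (k%:R + 1) <= (localization_number e)%:R :> R)%R.
Proof.
have deg_gt0 : 0 < degeneracy e by rewrite e_deg.
have T_gt0 : 0 < #|T|.
  have [H [_ /set0Pn[x _] _]] := degeneracy_subgraph deg_gt0.
  by apply/card_gt0P; exists x.
have [_ win _] := localization_numberP e T_gt0.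
have := cops_win_degeneracy e_sym e_irr deg_gt0 win; rewrite e_deg => lt_k.
rewrite /log natr1 ler_pdivrMr; last by rewrite ln_gt0 // ltr1n.
rewrite mulr_natl -lnXn ?ltr0n // ler_ln ?posrE ?exprn_gt0 ?ltr0n //.
by rewrite -natrX ler_nat.
Qed.
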